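(* Let $h(x)$ be a polynomial with real coefficients, let $A$ be an arbitrary $(m+1)$-dimensional unitary algebra over $K$ ($K=\mathbb{R}$ or $\mathbb{C}$) with basis $\{e_0,e_1,\dots,e_m\}$, and let $Q_{h,n}(x)=\sum_{k=0}^{m}F_{h,n+k}(x)\,e_k$ ($n\ge 0$) be the $h(x)$-Fibonacci polynomials in $A$. Then for $n=0,1,2,\ldots$ $$Q_{h,n}(x)=\frac{\alpha^{\ast}(x)\,\alpha^{n}(x)-\beta^{\ast}(x)\,\beta^{n}(x)}{\alpha(x)-\beta(x)},$$ where $\alpha^{\ast}(x)=\sum_{k=0}^{m}\alpha^{k}(x)\,e_k$ and $\beta^{\ast}(x)=\sum_{k=0}^{m}\beta^{k}(x)\,e_k$.
   Context: The real $h(x)$-Fibonacci polynomials $F_{h,n}(x)$ are defined by $F_{h,0}(x)=0$, $F_{h,1}(x)=1$ and $F_{h,n}(x)=h(x)F_{h,n-1}(x)+F_{h,n-2}(x)$ for $n\ge 2$. The scalars $$\alpha(x)=\frac{h(x)+\sqrt{h^{2}(x)+4}}{2},\qquad \beta(x)=\frac{h(x)-\sqrt{h^{2}(x)+4}}{2}$$ are the roots of $v^{2}-h(x)v-1=0$. Powers $\alpha^k(x),\beta^k(x)$ mean $(\alpha(x))^k,(\beta(x))^k$. The variable $x$ is real, and the identity is understood for the values $Q_{h,n}(x)\in A$. The algebra $A$ has a unit and a $K$-bilinear product; it is not assumed associative or commutative. *)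

(* Defs.v *)
From HB Require Import structures.
From mathcomp Require Import all_boot all_order all_algebra.
From mathcomp Require Import sesquilinear.
From mathcomp Require Import reals complex.

Set Implicit Arguments.
Unset Strict Implicit.
Unset Printing Implicit Defensive.

Import GRing.Theory Num.Theory.
Local Open Scope ring_scope.

Variant scalar_kind := RealScalars | ComplexScalars.

Definition scalars (R : realType) (s : scalar_kind) : fieldType :=
  match s with
  | RealScalars => R
  | ComplexScalars => R[i]%C
  end.

Definition of_real (R : realType) (s : scalar_kind) : R -> scalars R s :=
  match s return R -> scalars R s with
  | RealScalars => fun t => t
  | ComplexScalars => fun t => t%:C%C
  end.

(* MathComp's [algType] and [falgType] are associative; here the product is
   only required to be bilinear with a two-sided unit. *)
Record unitaryAlgebra (K : fieldType) := UnitaryAlgebra {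
  algebra_carrier :> vectType K;
  algebra_mul :
    {bilinear algebra_carrier -> algebra_carrier -> algebra_carrier};
  algebra_one : algebra_carrier;
  algebra_mul1l : left_id algebra_one algebra_mul;
  algebra_mul1r : right_id algebra_one algebra_mul
}.

Fixpoint hfib (R : realType) (h : {poly R}) (n : nat) : {poly R} :=
  match n with
  | 0 => 0
  | n1.+1 =>
      match n1 with
      | 0 => 1
      | n2.+1 => h * hfib h n1 + hfib h n2
      end
  end.

Definition alpha (R : realType) (h : {poly R}) (x : R) : R :=
  (h.[x] + Num.sqrt (h.[x] ^+ 2 + 4)) / 2.

Definition beta (R : realType) (h : {poly R}) (x : R) : R :=
  (h.[x] - Num.sqrt (h.[x] ^+ 2 + 4)) / 2.

Section InAlgebra.
Variables (R : realType) (s : scalar_kind) (A : unitaryAlgebra (scalars R s)).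
Variables (m : nat) (e : m.+1.-tuple A) (h : {poly R}).

Definition Q (n : nat) (x : R) : A :=
  \sum_(k < m.+1) of_real s (hfib h (n + k)).[x] *: tnth e k.

Definition alpha_star (x : R) : A :=
  \sum_(k < m.+1) of_real s (alpha h x) ^+ k *: tnth e k.

Definition beta_star (x : R) : A :=
  \sum_(k < m.+1) of_real s (beta h x) ^+ k *: tnth e k.

End InAlgebra.

(* Main.v *)
(** Since [alpha] and [beta] are the roots of [v ^ 2 = h v + 1], both power
    sequences satisfy the recurrence of [F], so Binet's formula
    [(alpha - beta) F_j = alpha ^ j - beta ^ j] follows from its cases [j = 0]
    and [j = 1].  Taking [j = n + k] gives the coefficient of [e_k]. *)

Require Import Defs.
From HB Require Import structures.
From mathcomp Require Import all_boot all_order all_algebra.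
From mathcomp Require Import reals complex ring.

Set Implicit Arguments.
Unset Strict Implicit.
Unset Printing Implicit Defensive.

Import Order.TTheory GRing.Theory Num.Theory.
Local Open Scope ring_scope.

(** Together with multiplicativity, this makes [of_real] a ring morphism for both scalar fields at
    once, so identities proved over the reals transfer to [scalars R s] without a case split on
    [s]. *)
Fact of_real_is_zmod_morphism (R : realType) (s : scalar_kind) :
  zmod_morphism (@of_real R s).
Proof. by case: s => //= u v; rewrite rmorphB. Qed.

Fact of_real_is_monoid_morphism (R : realType) (s : scalar_kind) :
  monoid_morphism (@of_real R s).
Proof. by case: s; split=> //= u v; rewrite rmorphM. Qed.

HB.instance Definition _ (R : realType) (s : scalar_kind) :=
  GRing.isZmodMorphism.Build R (scalars R s) (@of_real R s)
    (@of_real_is_zmod_morphism R s).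
HB.instance Definition _ (R : realType) (s : scalar_kind) :=
  GRing.isMonoidMorphism.Build R (scalars R s) (@of_real R s)
    (@of_real_is_monoid_morphism R s).

Lemma hfibSS (R : realType) (h : {poly R}) (n : nat) :
  hfib h n.+2 = h * hfib h n.+1 + hfib h n.
Proof. by []. Qed.

Lemma geometric_linear_recurrence (R : comPzRingType) (a v : R) (n : nat) :
  v ^+ 2 = a * v + 1 -> v ^+ n.+2 = a * v ^+ n.+1 + v ^+ n.
Proof. by move=> v2; rewrite -addn2 exprD v2 exprS; ring. Qed.

Section Roots.
Variables (R : realType) (h : {poly R}) (x : R).

(** Strict positivity keeps the two roots distinct for every real [x]; its weak form lets the square
    root be squared back. *)
Let disc_gt0 : 0 < h.[x] ^+ 2 + 4.
Proof. by rewrite ltr_wpDl ?sqr_ge0 ?ltr0n. Qed.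

Let sqr_disc : Num.sqrt (h.[x] ^+ 2 + 4) ^+ 2 = h.[x] ^+ 2 + 4.
Proof. exact/sqr_sqrtr/ltW. Qed.

Lemma alpha_sub_beta : alpha h x - beta h x = Num.sqrt (h.[x] ^+ 2 + 4).
Proof. by rewrite /alpha /beta; field. Qed.

Lemma alpha_sub_beta_neq0 : alpha h x - beta h x != 0.
Proof. by rewrite alpha_sub_beta gt_eqF // sqrtr_gt0. Qed.

Lemma alpha_sqr : alpha h x ^+ 2 = h.[x] * alpha h x + 1.
Proof. by rewrite /alpha expr_div_n sqrrD sqr_disc; field. Qed.

Lemma beta_sqr : beta h x ^+ 2 = h.[x] * beta h x + 1.
Proof. by rewrite /beta expr_div_n sqrrB sqr_disc; field. Qed.

Lemma hfib_binet (n : nat) :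
  (alpha h x - beta h x) * (hfib h n).[x] = alpha h x ^+ n - beta h x ^+ n.
Proof.
(* The recurrence has order two, so the induction carries two consecutive cases. *)
suff [] : (alpha h x - beta h x) * (hfib h n).[x]
            = alpha h x ^+ n - beta h x ^+ n /\
          (alpha h x - beta h x) * (hfib h n.+1).[x]
            = alpha h x ^+ n.+1 - beta h x ^+ n.+1 by [].
elim: n => [|n [IHn IHn1]]; first by rewrite /= !hornerE subrr.
split=> //; rewrite hfibSS hornerD hornerM mulrDr mulrCA IHn IHn1.
rewrite (geometric_linear_recurrence n alpha_sqr).
by rewrite (geometric_linear_recurrence n beta_sqr); ring.
Qed.

End Roots.

Theorem theorem3p3 (R : realType) (s : scalar_kind)
    (A : unitaryAlgebra (scalars R s)) (m : nat) (e : m.+1.-tuple A)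
    (e_basis : basis_of {: A} e) (h : {poly R}) (n : nat) (x : R) :
  Q e h n x =
    (of_real s (alpha h x) - of_real s (beta h x))^-1 *:
      (of_real s (alpha h x) ^+ n *: alpha_star e h x
       - of_real s (beta h x) ^+ n *: beta_star e h x).
Proof.
rewrite /Q /alpha_star /beta_star !scaler_sumr -sumrB scaler_sumr.
apply: eq_bigr => k _; rewrite !scalerA -scalerBl scalerA -!exprD.
(* Only the coefficients of [tnth e k] remain to be compared. Pulling [of_real] outside the powers
   and differences exposes the real Binet numerator at index [n + k], and the factor [alpha - beta]
   cancels. It stays nonzero in [scalars R s] because a ring morphism between fields is
   injective. *)
rewrite -!rmorphXn -!rmorphB -hfib_binet rmorphM mulKf //.
by rewrite fmorph_eq0 alpha_sub_beta_neq0.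
Qed.
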